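(* For $\alpha>0$ the type I exceptional Laguerre polynomial $L^{\mathrm{I}(\alpha)}_{m,m+j}(z)$ has $j$ simple zeros in $z\in(0,\infty)$ and $m$ simple zeros in $z\in(-\infty,0)$. The positive zeros of $L^{\mathrm{I}(\alpha)}_{m,m+j}(z)$ are located between consecutive zeros of $L^{(\alpha)}_j$ and $L^{(\alpha)}_{j-1}$, with the smallest positive zero of $L^{\mathrm{I}(\alpha)}_{m,m+j}(z)$ located to the left of the smallest zero of $L^{(\alpha)}_j$. The negative zeros of $L^{\mathrm{I}(\alpha)}_{m,m+j}(z)$ are located between the consecutive zeros of $\xi_{\alpha,m-1}$ and $\xi_{\alpha,m}$.
   Context: Here $m\ge 0$ is a fixed integer and $j=0,1,2,\dots$. For real $\alpha$ and integer $n\ge 0$, $L^{(\alpha)}_n(z)=\sum_{k=0}^n \binom{n+\alpha}{n-k}\frac{(-z)^k}{k!}$ is the classical Laguerre polynomial of degree $n$ (generalized binomial coefficients), and $L^{(\alpha)}_{-1}:=0$. Put $\xi_{\alpha,m}(z)=L^{(\alpha)}_m(-z)$ and $A^{\mathrm{I}}_{\alpha,m}[y]=\xi_{\alpha,m}\,y'-\xi_{\alpha+1,m}\,y$. The type I exceptional codimension $m$ Laguerre polynomials (type I $X_m$-Laguerre polynomials) are $L^{\mathrm{I}(\alpha)}_{m,m+j}=-A^{\mathrm{I}}_{\alpha-1,m}\big[L^{(\alpha-1)}_j\big]=\xi_{\alpha,m}L^{(\alpha-1)}_j-\xi_{\alpha-1,m}\,\big(L^{(\alpha-1)}_j\big)'$,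 $j=0,1,2,\dots$.
   Formalization: For m=0 the polynomial equals L_j^(α), and for j=0 it equals ξ_{α,m}, so strict location fails; ''to the left of'' zeros of L_j^(α) is weakened to ≤ when m=0, and ''to the right of'' zeros of ξ_{α,m} to ≥ when j=0. *)

(* Defs.v *)
From mathcomp Require Import all_boot all_order all_algebra.
From mathcomp Require Import reals.
From mathcomp Require Import polyrcf.
Set Implicit Arguments.
Unset Strict Implicit.
Unset Printing Implicit Defensive.
Import Order.TTheory GRing.Theory Num.Theory.
Local Open Scope ring_scope.

(* Generalized binomial coefficient a (a - 1) ... (a - k + 1) / k!. *)
Definition gbinom (R : realType) (a : R) (k : nat) : R :=
  (\prod_(i < k) (a - i%:R)) / k`!%:R.

(* Laguerre polynomial of degree n and parameter a.  The index is an integer,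
   so that n - 1 is not truncated at n = 0 and L_{-1} = 0. *)
Definition laguerre (R : realType) (a : R) (n : int) : {poly R} :=
  if n is Posz d then
    \poly_(k < d.+1) (gbinom (d%:R + a) (d - k)%N * (-1) ^+ k / k`!%:R)
  else 0.

(* xi_{a,m}(z) = L_m^(a)(-z) *)
Definition xi (R : realType) (a : R) (m : int) : {poly R} :=
  laguerre a m \Po (- 'X).

Definition opA1 (R : realType) (a : R) (m : nat) (y : {poly R}) : {poly R} :=
  xi a m * y^`() - xi (a + 1) m * y.

(* Type I X_m-Laguerre polynomial L^{I(a)}_{m,m+j}. *)
Definition xlaguerre1 (R : realType) (a : R) (m j : nat) : {poly R} :=
  - opA1 (a - 1) m (laguerre (a - 1) j).

Definition simple_root (R : realType) (p : {poly R}) (z : R) : bool :=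
  mup z p == 1%N.

(* Main.v *)
Require Import Defs.
From mathcomp Require Import all_boot all_order all_algebra.
From mathcomp Require Import reals.
From mathcomp Require Import polyrcf.
From mathcomp Require Import ring zify.
Set Implicit Arguments.
Unset Strict Implicit.
Unset Printing Implicit Defensive.
Import Order.TTheory GRing.Theory Num.Theory.
Local Open Scope ring_scope.

(* Contiguity relations turn the definition into
   P = xi_{a,m} L_j^(a) - xi_{a,m-1} L_{j-1}^(a).
   The three-term recurrence gives, by induction, that L_n^(a) has n positive
   zeros interlacing those of L_{n-1}^(a).  For m, j > 0 the sign of P is then
   known at 0, at the zeros of L_j^(a) and L_{j-1}^(a), and at those of
   xi_{a,m} and xi_{a,m-1}; it changes over m + j disjoint intervals, and
   deg P <= m + j, so each interval holds exactly one zero, which is simple.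
   The symmetry P_{m,j}(-z) = P_{j,m}(z) reduces the negative half-line to the
   positive one. *)

(** * Real zeros of polynomials: counting, separation and signs *)

Lemma prodrN_seq (R : comPzRingType) (I : Type) (r : seq I) (F : I -> R) :
  \prod_(i <- r) (- F i) = (-1) ^+ size r * \prod_(i <- r) F i.
Proof.
elim: r => [|i r IH]; first by rewrite !big_nil mulr1.
by rewrite !big_cons IH /= exprS -[- F i]mulN1r mulrACA.
Qed.

Section RootsR.
Variable R : rcfType.
Implicit Types (p : {poly R}) (s : seq R).

Lemma sorted_rootsR p : sorted <%R (rootsR p).
Proof. exact: sorted_roots. Qed.

Lemma mem_rootsR p z : p != 0 -> (z \in rootsR p) = root p z.
Proof. by move=> p0; rewrite -(roots_on_rootsR p0) in_itv. Qed.

Lemma ler_nth_sorted s i k : sorted <%R s -> (i <= k)%N -> (k < size s)%N ->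
  s`_i <= s`_k.
Proof.
move=> ss ik ks; rewrite (lt_sorted_leq_nth 0 ss) ?inE //.
exact: leq_ltn_trans ks.
Qed.

Lemma factor_full_roots p s : p != 0 -> (size p <= (size s).+1)%N ->
  sorted <%R s -> all (root p) s ->
  p = lead_coef p *: \prod_(z <- s) ('X - z%:P).
Proof.
move=> p0 sp ss rs.
have us : uniq s by apply: lt_sorted_uniq.
have spE : size p = (size s).+1.
  by apply/eqP; rewrite eqn_leq sp; apply: max_poly_roots.
by apply: all_roots_prod_XsubC; rewrite ?uniq_rootsE.
Qed.

Lemma factor_rootsR p : p != 0 -> (size p <= (size (rootsR p)).+1)%N ->
  p = lead_coef p *: \prod_(z <- rootsR p) ('X - z%:P).
Proof.
move=> p0 sp; apply: factor_full_roots => //; first exact: sorted_rootsR.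
by apply/allP => z; rewrite mem_rootsR.
Qed.

Lemma rootsR_full p s : p != 0 -> (size p <= (size s).+1)%N ->
  sorted <%R s -> all (root p) s ->
  rootsR p = s.
Proof.
move=> p0 sp ss rs.
apply: (lt_sorted_eq (sorted_rootsR p) ss) => z.
rewrite mem_rootsR // (factor_full_roots p0 sp ss rs).
by rewrite rootZ ?lead_coef_eq0 // root_prod_XsubC.
Qed.

(** The intermediate value theorem puts a zero in each of the [n] disjoint open intervals, and the
    degree bound leaves room for no other. Neighbouring intervals may share an end point. *)
Lemma rootsR_separated p n (lo hi : nat -> R) :
  p != 0 -> (size p <= n.+1)%N ->
  (forall i, (i < n)%N -> lo i < hi i /\ p.[lo i] * p.[hi i] < 0) ->
  (forall i, (i.+1 < n)%N -> hi i <= lo i.+1) ->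
  size (rootsR p) = n /\
  (forall i, (i < n)%N -> lo i < (rootsR p)`_i < hi i).
Proof.
move=> p0 sp Hs Hd.
have zP (i : 'I_n) : {x | x \in `]lo i, hi i[ & root p x}.
  by have [/ltW l h] := Hs i (ltn_ord i); apply: poly_ivtoo.
pose s := [seq (s2val (zP i)) | i : 'I_n].
have ssz : size s = n by rewrite size_map size_enum_ord.
have sE i (Hi : (i < n)%N) : s`_i = s2val (zP (Ordinal Hi)).
  rewrite (nth_map (Ordinal Hi)) ?size_enum_ord //.
  by congr (s2val (zP _)); apply: val_inj; rewrite /= nth_enum_ord.
have sI i : (i < n)%N -> lo i < s`_i < hi i.
  by move=> Hi; rewrite sE; have := s2valP (zP (Ordinal Hi)); rewrite in_itv.
have ss : sorted <%R s.
  apply/(sortedP 0) => i; rewrite ssz => Hi.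
  have /andP[_ h] := sI i (ltnW Hi).
  have /andP[l _] := sI _ Hi.
  exact: (lt_trans h (le_lt_trans (Hd _ Hi) l)).
have rs : all (root p) s.
  by apply/allP => _ /mapP[i _ ->]; apply: s2valP' (zP i).
by rewrite (@rootsR_full p s) ?ssz.
Qed.

Lemma mup_rootsR p z : p != 0 ->
  (size p <= (size (rootsR p)).+1)%N -> z \in rootsR p -> mup z p = 1%N.
Proof.
move=> p0 sp zs; rewrite (factor_rootsR p0 sp) -mul_polyC mupMr.
  rewrite mu_prod_XsubC count_uniq_mem ?zs //.
  exact: lt_sorted_uniq (sorted_rootsR p).
by rewrite rootC lead_coef_eq0.
Qed.

(** In p(t) p(0) = c^2 prod_z (t - z)(0 - z), a zero z > 0 contributes a negative factor exactly
    when z < t, and [i] counts these zeros. Comparing with p(0) > 0 makes the sign of the leading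
    coefficient c irrelevant. *)
Lemma signr_horner_rootsR p i t :
  (size p <= (size (rootsR p)).+1)%N -> {in rootsR p, forall z, 0 < z} ->
  0 < p.[0] -> (i <= size (rootsR p))%N ->
  ((0 < i)%N -> (rootsR p)`_i.-1 < t) ->
  ((i < size (rootsR p))%N -> t < (rootsR p)`_i) ->
  0 < (-1) ^+ i * p.[t].
Proof.
move=> sp spos p00 isz Hl Hr.
have p0 : p != 0 by apply: contraTneq p00 => ->; rewrite horner0 ltxx.
have pE := factor_rootsR p0 sp.
have ss := sorted_rootsR p.
set s := rootsR p in pE spos isz Hl Hr ss *.
have hE x : p.[x] = lead_coef p * \prod_(z <- s) (x - z).
  rewrite {1}pE hornerZ horner_prod; congr (_ * _).
  by apply: eq_bigr => z _; rewrite hornerXsubC.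
have pos : 0 < \prod_(z <- take i s) (- ((t - z) * (0 - z))).
  rewrite big_seq; apply: prodr_gt0 => z /(nthP 0)[k].
  rewrite size_takel // => ki <-; rewrite nth_take //.
  have ks : (k < size s)%N by apply: leq_trans isz.
  have p1 : 0 < s`_k by apply: spos; rewrite mem_nth.
  have i0 : (0 < i)%N by apply: leq_ltn_trans ki.
  have p2 : s`_k < t.
    apply: le_lt_trans (Hl i0); apply: ler_nth_sorted => //; lia.
  by rewrite sub0r mulrN opprK mulr_gt0 // subr_gt0.
have pos2 : 0 < \prod_(z <- drop i s) ((t - z) * (0 - z)).
  rewrite big_seq; apply: prodr_gt0 => z /(nthP 0)[k].
  rewrite size_drop => ki <-; rewrite nth_drop.
  have ks : (i + k < size s)%N by rewrite -ltn_subRL.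
  have p1 : 0 < s`_(i + k) by apply: spos; rewrite mem_nth.
  have p2 : t < s`_(i + k).
    have i0 : (i < size s)%N by apply: leq_ltn_trans ks; apply: leq_addr.
    apply: lt_le_trans (Hr i0) _; apply: ler_nth_sorted => //.
    exact: leq_addr.
  by rewrite -mulrNN !opprB subr0 mulr_gt0 // subr_gt0.
have : 0 < (-1) ^+ i * p.[t] * p.[0].
  have -> : (-1) ^+ i * p.[t] * p.[0] = lead_coef p ^+ 2 *
      (\prod_(z <- take i s) (- ((t - z) * (0 - z))) *
       \prod_(z <- drop i s) ((t - z) * (0 - z))).
    rewrite prodrN_seq size_takel // -[_ * _ * \prod_(_ <- drop _ _) _]mulrA.
    rewrite -big_cat cat_take_drop /=.
    rewrite !hE big_split /=; ring.
  apply: mulr_gt0 (mulr_gt0 pos pos2).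
  by rewrite exprn_even_gt0 //= lead_coef_eq0.
by rewrite pmulr_lgt0.
Qed.

Lemma rootsR_comp_oppX p :
  rootsR (p \Po - 'X) = rev [seq - z | z <- rootsR p].
Proof.
have [->|p0] := eqVneq p 0; first by rewrite comp_poly0 rootsR0.
apply: (lt_sorted_eq (sorted_rootsR _)).
  rewrite rev_sorted sorted_map; apply: sub_sorted (sorted_rootsR p) => x y /=.
  by rewrite ltrN2.
move=> z; rewrite mem_rev mem_rootsR; last first.
  by rewrite -size_poly_eq0 size_comp_poly2 ?size_poly_eq0 // size_polyN
    size_polyX.
rewrite root_comp hornerN hornerX -[in RHS](opprK z) mem_map.
  by rewrite mem_rootsR.
exact: oppr_inj.
Qed.

Lemma signrM_gt0 (x y : R) k l : 0 < (-1) ^+ k * x -> 0 < (-1) ^+ l * y ->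
  0 < (-1) ^+ (k + l) * (x * y).
Proof. by move=> hx hy; rewrite exprD mulrACA mulr_gt0. Qed.

Lemma signrS_mul_lt0 (x y : R) k : 0 < (-1) ^+ k * x -> 0 < (-1) ^+ k.+1 * y ->
  x * y < 0.
Proof.
move=> hx hy; have := signrM_gt0 hx hy.
by rewrite addnS exprS exprD -expr2 sqrr_sign mulr1 mulN1r oppr_gt0.
Qed.

(** Turns bounds by index on the sorted zeros into the positive and negative sublists of the final
    statement. *)
Lemma sign_split_filter s m : (m <= size s)%N ->
  (forall i, (i < m)%N -> s`_i < 0) ->
  (forall i, (m <= i < size s)%N -> 0 < s`_i) ->
  [seq z <- s | 0 < z] = drop m s /\ [seq z <- s | z < 0] = take m s.
Proof.
move=> ms neg pos.
have tn z : z \in take m s -> z < 0.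
  case/(nthP 0) => i; rewrite size_takel // => im <-.
  by rewrite nth_take ?neg.
have dp z : z \in drop m s -> 0 < z.
  case/(nthP 0) => i; rewrite size_drop nth_drop => im <-.
  by rewrite pos // leq_addr -ltn_subRL.
rewrite -[in [seq _ <- s | 0 < _]](cat_take_drop m s).
rewrite -[in [seq _ <- s | _ < 0]](cat_take_drop m s) !filter_cat.
split.
  rewrite (eq_in_filter (a2 := pred0)) ?filter_pred0 => [|z /tn/ltW].
    by rewrite (all_filterP _) //; apply/allP.
  by rewrite leNgt => /negbTE.
rewrite [X in _ ++ X](eq_in_filter (a2 := pred0)) ?filter_pred0 => [|z /dp/ltW].
  by rewrite cats0 (all_filterP _) //; apply/allP.
by rewrite leNgt => /negbTE.
Qed.

End RootsR.

(** * Laguerre polynomials: contiguity relations, recurrence, values at 0 and at infinity *)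

Section Laguerre.
Variable R : realType.
Implicit Types a b : R.

Lemma gbinom0 b : gbinom b 0 = 1.
Proof. by rewrite /gbinom big_ord0 divr1. Qed.

Lemma natS_neq0 n : n.+1%:R != 0 :> R.
Proof. by rewrite pnatr_eq0. Qed.

Lemma fact_neq0 n : n`!%:R != 0 :> R.
Proof. by rewrite pnatr_eq0 -lt0n fact_gt0. Qed.

Lemma gbinom_absorb b k : k.+1%:R * gbinom (b + 1) k.+1 = (b + 1) * gbinom b k.
Proof.
rewrite /gbinom big_ord_recl subr0 factS natrM.
under eq_bigr => i _.
  have -> : b + 1 - (lift ord0 i)%:R = b - i%:R.
    by rewrite /= /bump leq0n add1n -natr1; ring.
  over.
by field; rewrite ?fact_neq0 nat1r natS_neq0.
Qed.

Lemma gbinomS b k : gbinom b k.+1 = gbinom b k * (b - k%:R) / k.+1%:R.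
Proof.
rewrite /gbinom big_ord_recr factS natrM /=.
by field; rewrite ?fact_neq0 nat1r natS_neq0.
Qed.

Lemma gbinom_pascal b k : gbinom (b + 1) k.+1 = gbinom b k.+1 + gbinom b k.
Proof.
apply: (mulfI (natS_neq0 k)); rewrite gbinom_absorb gbinomS -(natr1 k).
by field; rewrite natr1 natS_neq0.
Qed.

Lemma coef_laguerre a n k : (laguerre a n%:Z)`_k =
  if (k <= n)%N then gbinom (n%:R + a) (n - k) * (-1) ^+ k / k`!%:R else 0.
Proof. by rewrite coef_poly ltnS. Qed.

Lemma subz1 n : n.+1%:Z - 1 = n%:Z. Proof. lia. Qed.

Lemma laguerre0 a : laguerre a 0%N = 1.
Proof.
apply/polyP => -[|k]; rewrite coef_laguerre coef1 //=.
by rewrite gbinom0 !mul1r invr1.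
Qed.

Lemma deriv_laguerre a n :
  (laguerre a n%:Z)^`() = - laguerre (a + 1) (n%:Z - 1).
Proof.
case: n => [|n].
  by rewrite laguerre0 -polyC1 derivC oppr0.
rewrite subz1; apply/polyP => k; rewrite coef_deriv coefN !coef_laguerre ltnS.
case: leqP => _; last by rewrite mul0rn oppr0.
rewrite subSS -[_ *+ k.+1]mulr_natr factS natrM exprS.
have -> : n.+1%:R + a = n%:R + (a + 1) by rewrite -natr1; ring.
by field; rewrite ?fact_neq0 nat1r natS_neq0.
Qed.

(** Pascal's rule, coefficient by coefficient; in the top degree both binomial coefficients have
    lower index 0. *)
Lemma laguerreB a n :
  laguerre a n%:Z = laguerre (a + 1) n%:Z - laguerre (a + 1) (n%:Z - 1).
Proof.
case: n => [|n]; first by rewrite !laguerre0 subr0.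
rewrite subz1; apply/polyP => k; rewrite coefB !coef_laguerre.
case: (ltngtP k n.+1) => [kn|kn|->].
- rewrite -(ltnS k n) kn subSn // addrA gbinom_pascal.
  have -> : n%:R + (a + 1) = n.+1%:R + a by rewrite -natr1; ring.
  by ring.
- by rewrite leqNgt (ltnW kn) /= subr0.
- by rewrite ltnn subnn !gbinom0 subr0.
Qed.

(** In degree k, write k = (n+1) - (n-k+1); absorption turns (n-k+1) binom(n+1+a, n-k+1) into
    (n+1+a) binom(n+a, n-k). *)
Lemma laguerre_absorb a n : 'X * (laguerre a n.+1)^`() =
  n.+1%:R *: laguerre a n.+1 - (n.+1%:R + a) *: laguerre a n.
Proof.
apply/polyP => k; rewrite coefXM coefB !coefZ coef_deriv.
have -> : (if k == 0 then 0 else (laguerre a n.+1)`_k.-1.+1 *+ k.-1.+1)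
  = k%:R * (laguerre a n.+1)`_k.
  by case: k => [|k] /=; rewrite ?mul0r // mulr_natl.
rewrite !coef_laguerre; case: (ltngtP k n.+1) => [kn|kn|->].
- rewrite -(ltnS k n) kn subSn //.
  have := gbinom_absorb (n%:R + a) (n - k).
  rewrite addrAC natr1 -natr1 natrB // => E.
  transitivity (
    n.+1%:R * (gbinom (n.+1%:R + a) (n - k).+1 * (-1) ^+ k / k`!%:R) -
    (n%:R - k%:R + 1) * gbinom (n.+1%:R + a) (n - k).+1 * ((-1) ^+ k / k`!%:R)).
    by rewrite -natr1; ring.
  by rewrite E; ring.
- by rewrite leqNgt (ltnW kn) /= !mulr0 subr0.
- by rewrite ltnn mulr0 subr0.
Qed.

(** Multiply L_{n+2}' = L_{n+1}' - L_{n+1} by X and eliminate both derivatives with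
    [laguerre_absorb] at n+1 and n. *)
Lemma laguerre_rec a n : n.+2%:R *: laguerre a n.+2 =
  ((n.+2%:R + n.+1%:R + a)%:P - 'X) * laguerre a n.+1
  - (n.+1%:R + a) *: laguerre a n.
Proof.
have E1 := laguerre_absorb a n.+1; have E2 := laguerre_absorb a n.
have D : (laguerre a n.+2)^`() = (laguerre a n.+1)^`() - laguerre a n.+1.
  rewrite !deriv_laguerre !subz1.
  by rewrite (laguerreB a n.+1) subz1; ring.
rewrite {}D mulrBr {}E2 in E1; move: E1.
move: (n.+2%:R : R) (n.+1%:R : R) => c2 c1.
rewrite -!mul_polyC !polyCD => E1.
rewrite -[LHS](subrK ((c2%:P + a%:P) * laguerre a n.+1)) -E1.
by ring.
Qed.

(** At 0 the left side of [laguerre_absorb] vanishes, so (n+1) L_{n+1}(0) = (n+1+a) L_n(0). *)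
Lemma laguerre_at0_gt0 a n : 0 < a -> 0 < (laguerre a n%:Z).[0].
Proof.
move=> a0; elim: n => [|n IH]; first by rewrite laguerre0 hornerC.
have := congr1 (horner^~ 0) (laguerre_absorb a n).
rewrite hornerM hornerX mul0r hornerD hornerN !hornerZ => /eqP.
rewrite eq_sym subr_eq0 => /eqP E.
have : 0 < n.+1%:R * (laguerre a n.+1).[0].
  by rewrite E mulr_gt0 // addr_gt0.
by rewrite pmulr_rgt0.
Qed.

Lemma laguerre_at0_ltS a n : 0 < a ->
  (laguerre a n%:Z).[0] < (laguerre a n.+1).[0].
Proof.
move=> a0; have L0 := laguerre_at0_gt0 n a0.
have := congr1 (horner^~ 0) (laguerre_absorb a n).
rewrite hornerM hornerX mul0r hornerD hornerN !hornerZ => /eqP.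
rewrite eq_sym subr_eq0 => /eqP E.
by rewrite -(ltr_pM2l (ltr0Sn R n)) E mulrDl ltrDl mulr_gt0.
Qed.

Lemma size_laguerre a n : (size (laguerre a n%:Z) <= n.+1)%N.
Proof. exact: size_poly. Qed.

(** The leading coefficient is (-1)^n / n!. The point [t] will close the rightmost interval of a
    bracketing. *)
Lemma laguerre_pinfty a n y :
  exists2 t, y < t & 0 < (-1) ^+ n * (laguerre a n%:Z).[t].
Proof.
pose q := (-1) ^+ n *: laguerre a n%:Z.
have : 0 < lead_coef q.
  rewrite lead_coefZ lead_coef_poly //= subnn gbinom0 mul1r.
    by rewrite mulrA -expr2 sqrr_sign mul1r invr_gt0 ltr0n fact_gt0.
  by rewrite mulf_neq0 ?signr_eq0 // invr_neq0 ?fact_neq0.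
move=> q0; have [M HM] := poly_pinfty_gt_lc q0.
exists (Num.max M (y + 1)).
  by rewrite lt_max ltrDl ltr01 orbT.
rewrite -hornerZ; apply: lt_le_trans q0 (HM _ _).
by rewrite le_max lexx.
Qed.

End Laguerre.

(** * Positivity and interlacing of the zeros of L_n, by induction on n *)

Section LaguerreRoots.
Variables (R : realType) (a : R).
Hypothesis a_gt0 : 0 < a.

Local Notation L n := (laguerre a n).
Local Notation x n := (rootsR (laguerre a n)).

Lemma laguerre_neq0 (n : nat) : L n != 0.
Proof.
by apply: contraTneq (laguerre_at0_gt0 n a_gt0) => ->; rewrite horner0 ltxx.
Qed.

Definition positive_rooted (n : nat) :=
  size (x n) = n /\ {in x n, forall z, 0 < z}.

(** Interlacing expressed through signs, the form that the recurrence carries from n to n+1. *)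
Definition alternates (n : nat) :=
  forall i, (i < n)%N -> 0 < (-1) ^+ i * (L (n%:Z - 1)).[(x n)`_i].

Definition interlaced (n : nat) :=
  forall i, (i < n)%N -> (x n.+1)`_i < (x n)`_i < (x n.+1)`_i.+1.

Lemma signr_laguerre n i t : positive_rooted n -> (i <= n)%N ->
  ((0 < i)%N -> (x n)`_i.-1 < t) -> ((i < n)%N -> t < (x n)`_i) ->
  0 < (-1) ^+ i * (L n).[t].
Proof.
move=> [sz Lp] i_n lo hi; apply: signr_horner_rootsR; rewrite ?sz //.
  exact: size_laguerre.
exact: laguerre_at0_gt0.
Qed.

(** At a zero of L_n the recurrence makes L_{n+1} a negative multiple of L_{n-1}. *)
Lemma alternates_laguerreS n i : positive_rooted n -> alternates n ->
  (i < n)%N -> 0 < (-1) ^+ i.+1 * (L n.+1).[(x n)`_i].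
Proof.
case: n => // n [sz _] alt i_n.
have := alt i i_n; rewrite subz1.
set z := (x n.+1)`_i => alt_i.
have Lz0 : (L n.+1).[z] = 0.
  by apply/rootP; rewrite -mem_rootsR ?laguerre_neq0 // mem_nth // sz.
have := congr1 (horner^~ z) (laguerre_rec a n).
rewrite /= hornerD hornerN hornerM !hornerZ Lz0 mulr0 sub0r => E.
have : 0 < n.+2%:R * ((-1) ^+ i.+1 * (L n.+2).[z]).
  by rewrite mulrCA E exprS mulN1r mulrNN mulrCA mulr_gt0 // addr_gt0.
by rewrite pmulr_rgt0.
Qed.

Lemma positive_rootedS n : positive_rooted n -> alternates n ->
  positive_rooted n.+1 /\ interlaced n.
Proof.
move=> Pn alt; have [sz Lp] := Pn.
have pos i : (i < n)%N -> 0 < (x n)`_i by move=> i_n; rewrite Lp ?mem_nth ?sz.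
have [t xt Lt] := laguerre_pinfty a n.+1 (x n)`_n.-1.
(* The ends are 0, the zeros of L_n, and [t]. Each zero of L_n closes one interval and opens the
   next, whence the interlacing. *)
pose lo i := if i is k.+1 then (x n)`_k else 0.
pose hi i := if (i < n)%N then (x n)`_i else t.
have t0 : 0 < t.
  (* For n = 0 the list of zeros is empty and its default entry is 0. *)
  apply: le_lt_trans xt; case: n sz pos {Pn alt Lp Lt lo hi} => [sz _|n sz pos].
    by rewrite nth_default ?sz.
  by rewrite ltW ?pos.
have Hs i : (i < n.+1)%N -> lo i < hi i /\
    (L n.+1).[lo i] * (L n.+1).[hi i] < 0.
  rewrite ltnS => i_n; split.
    case: i i_n => [|k] k_n; rewrite /lo /hi; first by case: ifP => // /pos.
    case: ltnP => [kn|nk].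
      rewrite (lt_sorted_ltn_nth 0 (sorted_rootsR _)) ?inE ?sz //; lia.
    by have -> : k = n.-1 by lia.
  apply: (@signrS_mul_lt0 _ _ _ i).
    case: i i_n => [|k] k_n; first by rewrite expr0 mul1r laguerre_at0_gt0.
    exact: alternates_laguerreS.
  rewrite /hi; case: ltnP => [|ni]; first exact: alternates_laguerreS.
  by have -> : i = n by lia.
have Hd i : (i.+1 < n.+1)%N -> hi i <= lo i.+1 by rewrite ltnS /hi => ->.
have [szS HS] :=
  rootsR_separated (laguerre_neq0 n.+1) (size_laguerre a n.+1) Hs Hd.
split.
  split=> // z /(nthP 0)[i]; rewrite szS => i_n <-.
  have /andP[+ _] := HS i i_n; apply: le_lt_trans.
  by case: i i_n => [|k] //; rewrite ltnS => /pos/ltW.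
move=> i i_n; have /andP[_] := HS i (ltnW i_n).
have /andP[+ _] := HS i.+1 i_n.
by rewrite /hi i_n => -> ->.
Qed.

(** By interlacing, exactly [i] zeros of L_n lie below the zero of index [i] of L_{n+1}. *)
Lemma alternatesS n :
  positive_rooted n -> interlaced n -> alternates n.+1.
Proof.
move=> Pn In i; rewrite ltnS subz1 => i_n; apply: signr_laguerre => //.
  by case: i i_n => // i i_n _; have /andP[] := In i i_n.
by move=> /In/andP[].
Qed.

Lemma laguerre_roots n : positive_rooted n /\ alternates n.
Proof.
elim: n => [|n [Pn alt]].
  by split=> //; rewrite /positive_rooted laguerre0 -polyC1 rootsRC.
have [PS In] := positive_rootedS Pn alt.
by split=> //; apply: alternatesS.
Qed.

Lemma laguerre_interlaced n : interlaced n.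
Proof.
by have [Pn alt] := laguerre_roots n; have [] := positive_rootedS Pn alt.
Qed.

Lemma laguerre_rooted n : positive_rooted n.
Proof. by have [] := laguerre_roots n. Qed.

Lemma laguerre_alternates n : alternates n.
Proof. by have [] := laguerre_roots n. Qed.

Lemma laguerre_gt0 (n : nat) t : t <= 0 -> 0 < (L n).[t].
Proof.
move=> t0; have [sz Lp] := laguerre_rooted n.
have := @signr_laguerre n 0 t (laguerre_rooted n).
rewrite expr0 mul1r; apply=> //.
by move=> n0; apply: le_lt_trans t0 _; rewrite Lp ?mem_nth ?sz.
Qed.

Lemma signr_laguerreS_root n i : (i < n)%N ->
  0 < (-1) ^+ i.+1 * (L n.+1).[(x n)`_i].
Proof.
exact: alternates_laguerreS (laguerre_rooted n) (@laguerre_alternates n).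
Qed.

End LaguerreRoots.

Lemma laguerre_nat_root (R : realType) (a : R) (n i : nat) : 0 < a ->
  (i < n)%N -> (laguerre a n).[(rootsR (laguerre a n))`_i] = 0.
Proof.
move=> a0 i_n; apply/rootP; rewrite -mem_rootsR ?laguerre_neq0 // mem_nth //.
by have [-> _] := laguerre_rooted a0 n.
Qed.

Lemma laguerre_root_gt0 (R : realType) (a : R) (n i : nat) : 0 < a ->
  (i < n)%N -> 0 < (rootsR (laguerre a n))`_i.
Proof.
move=> a0 i_n; have [sz pos] := laguerre_rooted a0 n.
by rewrite pos ?mem_nth ?sz.
Qed.

(** * The polynomials [xi] and the exceptional polynomials: contiguity form, symmetry, degree *)

Lemma horner_xi (R : realType) (a : R) (n : int) t :
  (xi a n).[t] = (laguerre a n).[- t].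
Proof. by rewrite horner_comp hornerN hornerX. Qed.

Lemma size_xi (R : realType) (a : R) (n : nat) : (size (xi a n) <= n.+1)%N.
Proof.
by rewrite size_comp_poly2 ?size_laguerre // size_polyN size_polyX.
Qed.

(** Reflection reverses the order of the zeros. *)
Lemma nth_rootsR_xi (R : realType) (a : R) (n i : nat) : 0 < a -> (i < n)%N ->
  (rootsR (xi a n))`_i = - (rootsR (laguerre a n))`_(n - i.+1).
Proof.
move=> a0 i_n; have [sz _] := laguerre_rooted a0 n.
rewrite rootsR_comp_oppX nth_rev size_map sz // (nth_map 0) // sz.
by rewrite subnSK // leq_subr.
Qed.

(** Expand L_j^(a-1) and xi_{a-1,m} by [laguerreB], and replace the derivative by -L_{j-1}^(a); the
    two products xi_{a,m} L_{j-1}^(a) cancel. *)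
Lemma xlaguerre1E (R : realType) (a : R) (m j : nat) : xlaguerre1 a m j =
  xi a m * laguerre a j - xi a (m%:Z - 1) * laguerre a (j%:Z - 1).
Proof.
rewrite /xlaguerre1 /opA1 deriv_laguerre (laguerreB (a - 1) j) subrK.
by rewrite /xi (laguerreB (a - 1) m) subrK comp_polyB; ring.
Qed.

(** Reflection swaps xi_{a,n} and L_n^(a), hence m and j in [xlaguerre1E]. *)
Lemma xlaguerre1_comp_oppX (R : realType) (a : R) (m j : nat) :
  xlaguerre1 a m j \Po - 'X = xlaguerre1 a j m.
Proof.
rewrite !xlaguerre1E comp_polyB !comp_polyM /xi -!comp_polyA.
have -> : (- 'X) \Po - 'X = 'X :> {poly R}.
  by rewrite raddfN /= comp_polyX opprK.
by rewrite !comp_polyXr; ring.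
Qed.

Lemma size_xlaguerre1 (R : realType) (a : R) (m j : nat) :
  (size (xlaguerre1 a m j) <= (m + j).+1)%N.
Proof.
have bound (b : R) (k n : nat) :
    (size (xi b k * laguerre b n)%R <= (k + n).+1)%N.
  apply: leq_trans (size_polyMleq _ _) _.
  have := size_xi b k; have := size_laguerre b n; lia.
rewrite xlaguerre1E; apply: leq_trans (size_polyD _ _) _.
rewrite geq_max bound size_polyN /=.
case: m => [|m]; first by rewrite /xi comp_poly0 mul0r size_poly0.
case: j => [|j]; first by rewrite mulr0 size_poly0.
by rewrite !subz1; apply: leq_trans (bound _ _ _) _; lia.
Qed.

Lemma xlaguerre1SE (R : realType) (a : R) (m j : nat) t :
  (xlaguerre1 a m.+1 j.+1).[t] =
  (laguerre a m.+1).[- t] * (laguerre a j.+1).[t]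
  - (laguerre a m).[- t] * (laguerre a j).[t].
Proof. by rewrite xlaguerre1E !subz1 !hornerE !horner_xi. Qed.

Lemma xlaguerre1_m0 (R : realType) (a : R) (j : nat) :
  xlaguerre1 a 0 j = laguerre a j.
Proof.
by rewrite xlaguerre1E /xi comp_poly0 mul0r subr0 laguerre0 comp_polyC mul1r.
Qed.

Lemma xlaguerre1_j0 (R : realType) (a : R) (m : nat) :
  xlaguerre1 a m 0 = xi a m.
Proof. by rewrite xlaguerre1E mulr0 subr0 laguerre0 mulr1. Qed.

(** L_n(0) is positive and strictly increasing in n, so the first product of [xlaguerre1E]
    dominates; the second is zero when m or j is 0. *)
Lemma xlaguerre1_at0_gt0 (R : realType) (a : R) (m j : nat) : 0 < a ->
  0 < (xlaguerre1 a m j).[0].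
Proof.
move=> a0; case: m => [|m]; first by rewrite xlaguerre1_m0 laguerre_at0_gt0.
case: j => [|j].
  by rewrite xlaguerre1_j0 horner_xi oppr0 laguerre_at0_gt0.
rewrite xlaguerre1SE oppr0 subr_gt0.
by rewrite ltr_pM ?laguerre_at0_ltS // ltW ?laguerre_at0_gt0.
Qed.

Lemma xlaguerre1_neq0 (R : realType) (a : R) (m j : nat) : 0 < a ->
  xlaguerre1 a m j != 0.
Proof.
move=> a0; apply: contraTneq (xlaguerre1_at0_gt0 m j a0) => ->.
by rewrite horner0 ltxx.
Qed.

(** * Bracketing and location of the zeros of the exceptional polynomials *)

Section Signs.
Variables (R : realType) (a : R) (m j : nat).
Hypothesis a_gt0 : 0 < a.
Local Notation P := (xlaguerre1 a m.+1 j.+1).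
Local Notation x n := (rootsR (laguerre a n)).

(* Prepending 0 to the zeros of L_j^(a) lists the left ends 0, y_0, y_1, ... of
   the intervals in which the positive zeros of P are sought. *)
Lemma xlaguerre1_positive_bracket i : (i < j.+1)%N ->
  0 <= (0 :: x j)`_i < (x j.+1)`_i /\ P.[(0 :: x j)`_i] * P.[(x j.+1)`_i] < 0.
Proof.
move=> i_j; split.
  case: i i_j => [|i] i_j /=; first by rewrite lexx laguerre_root_gt0.
  rewrite ltnS in i_j.
  have /andP[_ ->] := laguerre_interlaced a_gt0 i_j.
  by rewrite ltW ?laguerre_root_gt0.
apply: (@signrS_mul_lt0 _ _ _ i).
  case: i i_j => [|i] i_j /=.
    by rewrite expr0 mul1r; apply: xlaguerre1_at0_gt0.
  rewrite ltnS in i_j.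
  (* At a zero y of L_j only L_{m+1}(-y) L_{j+1}(y) survives, and its first factor is positive. *)
  rewrite xlaguerre1SE (laguerre_nat_root a_gt0 i_j) mulr0 subr0 mulrCA.
  by rewrite mulr_gt0 ?signr_laguerreS_root // laguerre_gt0 //
    oppr_le0 ltW ?laguerre_root_gt0.
(* At a zero x of L_{j+1} only -L_m(-x) L_j(x) survives, and L_j(x) has sign (-1)^i. *)
rewrite xlaguerre1SE (laguerre_nat_root a_gt0 i_j) mulr0 sub0r exprS.
rewrite mulN1r mulrNN mulrCA.
have := laguerre_alternates a_gt0 i_j; rewrite subz1 => alt.
by rewrite mulr_gt0 // laguerre_gt0 // oppr_le0 ltW ?laguerre_root_gt0.
Qed.

End Signs.

Lemma rootsR_xlaguerre1SS (R : realType) (a : R) (m j : nat) : 0 < a ->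
  let s := rootsR (xlaguerre1 a m.+1 j.+1) in
  let x n := rootsR (laguerre a n) in
  [/\ size s = (m.+1 + j.+1)%N,
      forall i, (i < m.+1)%N ->
        - (x m.+1)`_(m - i) < s`_i < - (0 :: x m)`_(m - i) &
      forall i, (i < j.+1)%N -> (0 :: x j)`_i < s`_(m.+1 + i) < (x j.+1)`_i].
Proof.
move=> a0 s x.
(* The first m+1 intervals are the positive brackets for the swapped indices, reflected; [m - i]
   puts them in increasing order. *)
pose lo i :=
  if (i < m.+1)%N then - (x m.+1)`_(m - i) else (0 :: x j)`_(i - m.+1).
pose hi i :=
  if (i < m.+1)%N then - (0 :: x m)`_(m - i) else (x j.+1)`_(i - m.+1).
have hN t : (xlaguerre1 a m.+1 j.+1).[- t] = (xlaguerre1 a j.+1 m.+1).[t].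
  rewrite -(xlaguerre1_comp_oppX a m.+1 j.+1).
  by rewrite horner_comp (hornerN 'X) hornerX.
have Hs i : (i < m.+1 + j.+1)%N -> lo i < hi i /\
    (xlaguerre1 a m.+1 j.+1).[lo i] * (xlaguerre1 a m.+1 j.+1).[hi i] < 0.
  move=> i_mj; rewrite /lo /hi; case: ltnP => [i_m|m_i].
    have i_m' : (m - i < m.+1)%N by lia.
    have [/andP[_ lt_x] neg] := xlaguerre1_positive_bracket j a0 i_m'.
    by rewrite ltrN2 !hN mulrC.
  have i_j : (i - m.+1 < j.+1)%N by lia.
  by have [/andP[_ lt_x] neg] := xlaguerre1_positive_bracket m a0 i_j.
have Hd i : (i.+1 < m.+1 + j.+1)%N -> hi i <= lo i.+1.
  rewrite /lo /hi => i_mj; case: ltnP => [i_m|m_i].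
    case: ltnP => [Si_m|m_Si].
      have -> : (m - i = (m - i.+1).+1)%N by lia.
      have lt_m : (m - i.+1 < m)%N by lia.
      by rewrite lerN2 /=; have /andP[/ltW] := laguerre_interlaced a0 lt_m.
    (* The last negative and the first positive interval meet at 0. *)
    have -> : (m - i = 0)%N by lia.
    have -> : (i.+1 - m.+1 = 0)%N by lia.
    by rewrite /= oppr0.
  rewrite ltnNge (leqW m_i) /= subSn //=.
  have lt_j : (i - m.+1 < j)%N by lia.
  by have /andP[/ltW] := laguerre_interlaced a0 lt_j.
have [sz S] := rootsR_separated (xlaguerre1_neq0 m.+1 j.+1 a0)
  (size_xlaguerre1 _ _ _) Hs Hd.
split=> // i Hi.
  have := S i (ltn_addr _ Hi); by rewrite /lo /hi Hi.
have Hi' : (m.+1 + i < m.+1 + j.+1)%N by rewrite ltn_add2l.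
by have := S _ Hi'; rewrite /lo /hi ltnNge leq_addr /= addKn.
Qed.

(* rootsR p is the strictly increasing list of all real roots of p, and the
   empty list if p = 0.  The i-th positive zero coincides with that of L_j^(a)
   exactly when m = 0, and the i-th negative zero coincides with that of
   xi_{a,m} exactly when j = 0; hence the two conditional inequalities. *)
Theorem proposition3p2 (R : realType) (a : R) (m j : nat) (ha : 0 < a) :
  let P := xlaguerre1 a m j in
  let zpos : seq R := [seq z <- rootsR P | 0 < z] in
  let zneg : seq R := [seq z <- rootsR P | z < 0] in
  let x := rootsR (laguerre a j) in
  let y := rootsR (laguerre a (j%:Z - 1)) in
  let u := rootsR (xi a m) in
  let v := rootsR (xi a (m%:Z - 1)) in
  [/\ size zpos = j /\ all (simple_root P) zpos,
      size zneg = m /\ all (simple_root P) zneg,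
      (forall i : nat, (i < j)%N -> zpos`_i < x`_i ?<= if (m == 0%N))
      /\ (forall i : nat, (i.+1 < j)%N -> x`_i < y`_i < zpos`_i.+1)
    & (forall i : nat, (i < m)%N -> u`_i < zneg`_i ?<= if (j == 0%N))
      /\ (forall i : nat, (i.+1 < m)%N -> zneg`_i < v`_i < u`_i.+1)].
Proof.
move=> P zpos zneg x y u v.
have Hu i : (i < m)%N -> u`_i = - (rootsR (laguerre a m))`_(m - i.+1).
  exact: nth_rootsR_xi.
have Hxy i : (i.+1 < j)%N -> x`_i < y`_i < x`_i.+1.
  rewrite /x /y; case: j {P zpos zneg x y} => // j; rewrite subz1.
  apply: (@laguerre_interlaced _ _ ha j i).
have Hvu i : (i.+1 < m)%N -> u`_i < v`_i < u`_i.+1.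
  move=> i_m; rewrite !Hu // 1?ltnW // /v.
  case: m i_m {P zpos zneg u v Hu} => // m i_m.
  rewrite subz1 nth_rootsR_xi // !ltrN2.
  have lt_m : (m - i.+1 < m)%N by lia.
  have := laguerre_interlaced ha lt_m.
  by rewrite andbC -subSn.
have P0 : P != 0 by exact: xlaguerre1_neq0.
(* In the increasing list of all zeros the first m are negative, so the positive zero of index [i]
   has index [m + i] there. *)
suff [szP neg pos] : [/\ size (rootsR P) = (m + j)%N,
    forall i, (i < m)%N -> [/\ (rootsR P)`_i < 0,
      u`_i < (rootsR P)`_i ?<= if (j == 0%N) &
      (i.+1 < m)%N -> (rootsR P)`_i < v`_i] &
    forall i, (i < j)%N -> [/\ 0 < (rootsR P)`_(m + i),
      (rootsR P)`_(m + i) < x`_i ?<= if (m == 0%N) &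
      (0 < i)%N -> y`_i.-1 < (rootsR P)`_(m + i)]].
  have [|i /neg[]//|i|posE negE] := @sign_split_filter _ (rootsR P) m.
  - by rewrite szP leq_addr.
  - rewrite szP => /andP[m_i i_mj]; have [|+ _ _] := pos (i - m)%N; first lia.
    by rewrite subnKC.
  have simple z : z \in rootsR P -> simple_root P z.
    by move=> zP; apply/eqP; apply: mup_rootsR; rewrite // szP size_xlaguerre1.
  split.
  - split; first by rewrite /zpos posE size_drop szP addKn.
    by apply/allP => z; rewrite mem_filter => /andP[_ /simple].
  - split; first by rewrite /zneg negE size_takel // szP leq_addr.
    by apply/allP => z; rewrite mem_filter => /andP[_ /simple].
  - split=> i i_j; rewrite /zpos posE nth_drop; first by have [] := pos i i_j.
    have /andP[-> _] := Hxy i i_j.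
    by have [_ _ ->] := pos i.+1 i_j.
  - split=> i i_m; rewrite /zneg negE nth_take // 1?ltnW //.
      by have [] := neg i i_m.
    have /andP[_ ->] := Hvu i i_m.
    by have [_ _ ->] := neg i (ltnW i_m).
(* For m = 0, P is L_j: the comparison with [x] is an equality and the bound by [y] is Laguerre
   interlacing. *)
case: m => [|m] in P zpos zneg u v Hu Hvu P0 *.
  rewrite /P xlaguerre1_m0 -/x; split=> [|//|i i_j].
    by have [] := laguerre_rooted ha j.
  rewrite add0n lteifT lexx laguerre_root_gt0 //; split=> //.
  by case: i i_j => // i i_j _; have /andP[] := Hxy i i_j.
(* For j = 0, P is xi_{a,m}, with equality in the comparison with [u]. *)
case: j => [|j] in P zpos zneg x y Hxy P0 *.
  rewrite /P xlaguerre1_j0 -/u addn0; split=> [|i i_m|//].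
    rewrite /u rootsR_comp_oppX size_rev size_map.
    by have [] := laguerre_rooted ha m.+1.
  rewrite lteifT lexx Hu // oppr_lt0 laguerre_root_gt0 //; last lia.
  split=> // i_m'; rewrite -Hu //.
  by have /andP[] := Hvu i i_m'.
have [szP neg pos] := rootsR_xlaguerre1SS m j ha.
split=> // i.
  move=> i_m; have /andP[lo hi] := neg i i_m; rewrite Hu // subSS lteifF.
  split=> //.
    apply: lt_le_trans hi _; rewrite oppr_le0.
    case: (m - i)%N (leq_subr i m) => //= k k_m.
    by rewrite ltW ?laguerre_root_gt0.
  move=> i_m'; apply: (lt_le_trans hi); rewrite /v subz1 nth_rootsR_xi //.
  by rewrite -subnSK.
move=> i_j; have /andP[lo hi] := pos i i_j; rewrite lteifF.
split=> //.
  apply: le_lt_trans lo; case: i i_j {hi} => //= i i_j.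
  by rewrite ltW ?laguerre_root_gt0.
by rewrite /y subz1; case: i i_j lo {hi}.
Qed.
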